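(* Let $k_1,k_2\ge 1$ be integers and let $N_1,N_2\ge 1$ be odd square-free integers. Let $f=\sum_{n\ge1}a(n)q^n\in S^{\mathrm{new}}_{k_1+\frac12}(4N_1,\chi_0)$ and $g=\sum_{n\ge1}b(n)q^n\in S^{\mathrm{new}}_{k_2+\frac12}(4N_2,\chi_0)$ be two distinct non-zero cuspidal eigenforms for the operators $T_{p^2}$ for all primes $p\nmid 2N_1$, respectively $p\nmid 2N_2$, where $\chi_0$ is the trivial character, and let $t\ge1$ be a square-free integer with $a(t)=b(t)=1$. Suppose that the Shimura lifts $F=\sum_{n\ge1} A(n)q^n\in S^{\mathrm{new}}_{2k_1}(2N_1)$ of $f$ and $G=\sum_{n\ge1} B(n)q^n\in S^{\mathrm{new}}_{2k_2}(2N_2)$ of $g$ with respect to $t$ are cuspidal eigenforms for the operators $T_p$ for all primes $p\nmid 2N_1$, respectively $p\nmid 2N_2$ (they are then primitive forms). Assume that $F$ and $G$ are not twists of each other and that the pair Sato–Tate conjecture holds for $(F,G)$. Then the sequence $\{a(tp^2)b(tp^2)\}_{p\ \mathrm{prime}}$ changes sign infinitely often. Moreover, each of the sets $\mathbb{P}_{>0},\mathbb{P}_{<0},\mathbb{P}_{\ge0},\mathbb{P}_{\le0}$ has natural density $1/2$, and $\mathbb{P}_{=0}$ has natural density $0$, where for a relation $\ast\in\{>,<,\ge,\le,=\}$ one puts $\mathbb{P}_{\ast0}=\{p\text{ prime}:\ p\nmid 2N_1N_2,\ a(tp^2)b(tp^2)\ast 0\}$.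
   Context: For a natural number $k$ and an odd square-free $N\ge1$, $S_{k+\frac12}(4N,\chi_0)$ is the space of cusp forms of weight $k+\frac12$ and level $4N$ with trivial character; when $k=1$ one works only with the orthogonal complement (for the Petersson inner product) of the subspace spanned by single-variable unary theta functions. $S^{+}_{k+\frac12}(4N,\chi_0)$ is Kohnen's plus subspace, consisting of the forms whose $n$-th Fourier coefficient vanishes for $n\equiv 2,(-1)^{k+1}\pmod 4$. $S^{\mathrm{new}}_{k+\frac12}(4N,\chi_0)$ is the space of newforms in the sense of Manickam–Ramakrishnan–Vasudevan: the Petersson-orthogonal complement in $S_{k+\frac12}(4N,\chi_0)$ of the old space spanned by $S_{k+\frac12}(4N/p,\chi_0)$ and $S_{k+\frac12}(4N/p,\chi_0)|U(p^2)$ for primes $p\mid N$, together with $S^+_{k+\frac12}(4N,\chi_0)$ and $S^+_{k+\frac12}(4N,\chi_0)|U(4)$, where $U(m)$ sends $\sum a(n)q^n$ to $\sum a(mn)q^n$. $S^{\mathrm{new}}_{2k}(2N)$ is the usual space of newforms of weight $2k$ and level $\Gamma_0(2N)$ with trivial character; a primitive form is a normalized newform (Hecke eigenform with first coefficient $1$). $T_{p^2}$ and $T_p$ are the usual Hecke operators in half-integral and integral weight. The Shimura lift of $f$ with respect to the square-free integer $t$ is $F=\sum_{n\ge1}A(n)q^n$ with $A(n)=\sum_{d\mid n,\ (d,2N_1)=1}\chi_1(d)\,d^{k_1-1}a\!\left(\frac{tn^2}{d^2}\right)$, where $\chi_1$ is the quadratic character $d\mapsto\left(\frac{(-1)^{k_1}t}{d}\right)$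 on $d$ prime to $2N_1$; $G=\sum_{n\ge 1} B(n)q^n$ is defined in the same way from $g$ with $k_2,N_2$. The numbers $A(n),B(n)$, and hence $a(tp^2),b(tp^2)$ for primes $p$, are real. ''Not twists of each other'' means that neither form is the twist of the other by a Dirichlet character. The Sato–Tate measure $\mu_{\mathrm{ST}}$ is the probability measure $\frac{2}{\pi}\sqrt{1-u^2}\,du$ on $[-1,1]$. The natural density of a set $S$ of primes is $d(S)=\lim_{x\to\infty}\frac{\#\{p\le x:\ p\in S\}}{\pi(x)}$, where $\pi(x)$ is the number of primes $\le x$. The pair Sato–Tate conjecture for $(F,G)$ is the statement that for any two subintervals $J_1,J_2\subseteq[-1,1]$ the set of primes $p\nmid 2N_1N_2$ with $\frac{A(p)}{2p^{k_1-\frac12}}\in J_1$ and $\frac{B(p)}{2p^{k_2-\frac12}}\in J_2$ has natural density $\mu_{\mathrm{ST}}(J_1)\mu_{\mathrm{ST}}(J_2)$. A real sequence indexed by primes changes sign infinitely often if it takes positive values at infinitely many primes and negative values at infinitely many primes. *)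

(* Defs.v *)
From HB Require Import structures.
From mathcomp Require Import all_boot all_order all_algebra.
From mathcomp Require Import complex.
From mathcomp Require Import all_classical all_reals all_analysis.

Set Implicit Arguments.
Unset Strict Implicit.
Unset Printing Implicit Defensive.

Import Order.TTheory GRing.Theory Num.Theory.
Import numFieldNormedType.Exports.

Local Open Scope classical_set_scope.
Local Open Scope ring_scope.
Local Open Scope complex_scope.

Definition squarefree (n : nat) : Prop :=
  (0 < n)%N /\ forall p : nat, prime p -> ~~ (p ^ 2 %| n)%N.

Definition legendre (a : int) (p : nat) : int :=
  if (p%:Z %| a)%Z then 0
  else if [exists x : 'I_p, (x%:Z ^+ 2 == a %[mod p%:Z])%Z] then 1 else -1.

(* Meant for odd d > 0 only. *)
Definition jacobi (a : int) (d : nat) : int :=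
  \prod_(p <- primes d) legendre a p ^+ logn p d.

Definition SL2Z : set 'M[int]_2 := [set g | \det g = 1].

Definition Gamma0 (M : nat) : set 'M[int]_2 :=
  [set g | SL2Z g /\ (M%:Z %| g 1%R 0%R)%Z].

Section Forms.
Variable R : realType.
Local Notation C := R[i].

Definition dirichlet_character (r : nat) (chi : int -> C) : Prop :=
  [/\ (0 < r)%N,
      chi 1 = 1,
      forall m n : int, chi (m * n) = chi m * chi n,
      forall m : int, chi (m + r%:Z) = chi m &
      forall m : int, (chi m != 0) = coprimez m r%:Z].

Definition is_twist (A B : nat -> C) : Prop :=
  exists (r : nat) (chi : int -> C),
    dirichlet_character r chi /\ forall n : nat, A n = chi n%:Z * B n.

(* Only the values of a form on the upper half-plane matter: forms are total
   functions C -> C, and every notion below looks at these values only. *)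
Definition upper_half : set C := [set z | 0 < complex.Im z].

(* expi z = exp (2 pi i z) *)
Definition expi (z : C) : C :=
  (expR (- (2 * pi * complex.Im z)))%:C *
  (cos (2 * pi * complex.Re z) +i* sin (2 * pi * complex.Re z)).

Definition qexp (f : C -> C) (a : nat -> C) : Prop :=
  forall z, upper_half z ->
    series (fun n => a n * expi (n%:R * z)) @ \oo --> (f z : C^o).

Definition theta (z : C) : C :=
  1 + 2 * lim (series (fun n => expi ((n.+1 ^ 2)%:R * z) : C^o) @ \oo).

Definition denom (g : 'M[int]_2) (z : C) : C := (g 1 0)%:~R * z + (g 1 1)%:~R.

Definition moebius (g : 'M[int]_2) (z : C) : C :=
  ((g 0 0)%:~R * z + (g 0 1)%:~R) / denom g z.

(* Shimura's automorphy factor of weight 1/2 on Gamma_0(4), equal to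
   (c/d) eps_d^-1 (cz+d)^(1/2). *)
Definition theta_factor (g : 'M[int]_2) (z : C) : C :=
  theta (moebius g z) / theta z.

(* The last condition is the vanishing at all cusps: it bounds
   |f(gz)| |cz+d|^(-kappa), so no branch of (cz+d)^kappa has to be chosen when
   the weight kappa is not an integer. *)
Definition cusp_form (kappa : R) (J : 'M[int]_2 -> C -> C) (M : nat) :
    set (C -> C) :=
  [set f | [/\
    forall z, upper_half z -> derivable (f : C^o -> C^o) z 1,
    forall g, Gamma0 M g ->
      forall z, upper_half z -> f (moebius g z) = J g z * f z &
    forall g, SL2Z g -> forall e : R, 0 < e -> exists Y : R,
      forall z, upper_half z -> Y < complex.Im z ->
        Normc.normc (f (moebius g z)) / (Normc.normc (denom g z) `^ kappa)
          < e]].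

(* Ford fundamental domain of Gamma_0(M): the part of a width-one strip lying
   outside all isometric circles |cz+d| = 1, where (c,d) runs through the
   bottom rows of Gamma_0(M) with c > 0. *)
Definition ford_domain (M : nat) : set (R * R) :=
  [set z | [/\ 0 <= z.1 <= 1, 0 < z.2 &
    forall c d : int, 0 < c -> (M%:Z %| c)%Z -> coprimez c d ->
      1 <= (c%:~R * z.1 + d%:~R) ^+ 2 + (c%:~R * z.2) ^+ 2]].

(* Without the customary normalisation by the index of Gamma_0(M), which does
   not affect orthogonality. *)
Definition petersson (kappa : R) (M : nat) (f g : C -> C) : C :=
  let F (z : R * R) : C :=
    f (z.1 +i* z.2) * (g (z.1 +i* z.2))^* * (z.2 `^ (kappa - 2))%:C in
  let mu := (@lebesgue_measure R \x @lebesgue_measure R)%E in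
  (\int[mu]_(z in ford_domain M) complex.Re (F z)) +i*
  (\int[mu]_(z in ford_domain M) complex.Im (F z)).

Definition span (G : set (C -> C)) : set (C -> C) :=
  [set f | exists (n : nat) (c : 'I_n -> C) (h : 'I_n -> C -> C),
    (forall i, G (h i)) /\
    forall z, upper_half z -> f z = \sum_(i < n) c i * h i z].

Definition orthogonal_to (kappa : R) (M : nat) (S : set (C -> C)) :
    set (C -> C) :=
  [set f | forall h, S h -> petersson kappa M f h = 0].

Definition Uop (m : nat) (S : set (C -> C)) : set (C -> C) :=
  [set h | exists (f : C -> C) (a : nat -> C),
    [/\ S f, qexp f a & qexp h (fun n => a (m * n)%N)]].

(* In the half-integral weight definitions the level is 4N, not N. *)

Definition half_weight (k : nat) : R := k%:R + 2^-1.

Definition cusp_half_full (k N : nat) : set (C -> C) :=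
  cusp_form (half_weight k)
    (fun g z => theta_factor g z ^+ (2 * k).+1) (4 * N)%N.

(* sum_(m >= 1) psi(m) m q^(t m^2), with psi an odd character *)
Definition unary_theta : set (C -> C) :=
  [set h | exists (r : nat) (psi : int -> C) (t : nat),
    [/\ dirichlet_character r psi, psi (-1) = -1, (0 < t)%N &
        qexp h (fun n => \sum_(1 <= m < n.+1 | (t * m ^ 2 == n)%N)
                           psi m%:Z * m%:R)]].

Definition cusp_half (k N : nat) : set (C -> C) :=
  [set f | cusp_half_full k N f /\
    (k = 1%N ->
     orthogonal_to (half_weight k) (4 * N)%N
       (span (cusp_half_full k N `&` unary_theta)) f)].

(* (-1)^(k+1) mod 4 is 1 for odd k and 3 for even k *)
Definition cusp_half_plus (k N : nat) : set (C -> C) :=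
  [set f | cusp_half k N f /\ exists a : nat -> C, qexp f a /\
    forall n : nat,
      (n %% 4 == 2)%N || (n %% 4 == if odd k then 1 else 3)%N -> a n = 0].

Definition old_half (k N : nat) : set (C -> C) :=
  span ([set h | exists p : nat, [/\ prime p, (p %| N)%N &
           (cusp_half k (N %/ p) `|` Uop (p ^ 2) (cusp_half k (N %/ p))) h]]
        `|` (cusp_half_plus k N `|` Uop 4 (cusp_half_plus k N))).

Definition new_half (k N : nat) : set (C -> C) :=
  cusp_half k N `&` orthogonal_to (half_weight k) (4 * N)%N (old_half k N).

Definition hecke_half (k p : nat) (a : nat -> C) (n : nat) : C :=
  a (p ^ 2 * n)%N
  + (legendre ((-1) ^+ k * n%:Z) p)%:~R * (p ^ k.-1)%:R * a n
  + (if (p ^ 2 %| n)%N then (p ^ (2 * k).-1)%:R * a (n %/ p ^ 2)%N else 0).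

Definition hecke_eigen_half (k N : nat) (a : nat -> C) : Prop :=
  forall p : nat, prime p -> ~~ (p %| 2 * N)%N ->
    exists lambda : C, forall n : nat, hecke_half k p a n = lambda * a n.

Definition cusp_int (w M : nat) : set (C -> C) :=
  cusp_form w%:R (fun g z => denom g z ^+ w) M.

Definition old_int (w M : nat) : set (C -> C) :=
  span [set h | exists (L d : nat) (f : C -> C),
    [/\ (L * d %| M)%N, (L < M)%N, cusp_int w L f &
        h = fun z => f (d%:R * z)]].

Definition new_int (w M : nat) : set (C -> C) :=
  cusp_int w M `&` orthogonal_to w%:R M (old_int w M).

Definition hecke_int (w p : nat) (A : nat -> C) (n : nat) : C :=
  A (p * n)%N + (if (p %| n)%N then (p ^ w.-1)%:R * A (n %/ p)%N else 0).

Definition hecke_eigen_int (w M : nat) (A : nat -> C) : Prop :=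
  forall p : nat, prime p -> ~~ (p %| M)%N ->
    exists lambda : C, forall n : nat, hecke_int w p A n = lambda * A n.

Definition shimura_lift (k N t : nat) (a : nat -> C) (n : nat) : C :=
  \sum_(d <- divisors n | coprime d (2 * N))
    (jacobi ((-1) ^+ k * t%:Z) d)%:~R * (d ^ k.-1)%:R
    * a (t * n ^ 2 %/ d ^ 2)%N.

Definition natural_density (S : set nat) (delta : R) : Prop :=
  (count (fun p => prime p && `[< S p >]) (iota 0 x.+1))%:R
    / (count prime (iota 0 x.+1))%:R @[x --> \oo] --> delta.

Definition sato_tate (J : set R) : R :=
  \int[@lebesgue_measure R]_(u in J) (2 / pi * Num.sqrt (1 - u ^+ 2)).

Definition normalized_coef (k : nat) (A : nat -> C) (p : nat) : C :=
  A p / (2 * p%:R `^ (k%:R - 2^-1))%:C.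

Definition pair_sato_tate (k1 N1 : nat) (A : nat -> C)
    (k2 N2 : nat) (B : nat -> C) : Prop :=
  forall J1 J2 : interval R,
    [set` J1] `<=` [set` `[-1, 1]] -> [set` J2] `<=` [set` `[-1, 1]] ->
    natural_density
      [set p | [/\ prime p, ~~ (p %| 2 * N1 * N2)%N,
        [set u%:C | u in [set` J1]] (normalized_coef k1 A p) &
        [set u%:C | u in [set` J2]] (normalized_coef k2 B p)]]
      (sato_tate [set` J1] * sato_tate [set` J2]).

(* The order of R[i] is the partial one, in which 0 < z means that z is a
   positive real. *)
Definition sign_changes_infinitely_often (c : nat -> C) : Prop :=
  forall m : nat,
    (exists p : nat, [/\ prime p, (m < p)%N & 0 < c p]) /\
    (exists p : nat, [/\ prime p, (m < p)%N & c p < 0]).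

Definition good_primes (N1 N2 : nat) (c : nat -> C) (P : C -> bool) : set nat :=
  [set p | [/\ prime p, ~~ (p %| 2 * N1 * N2)%N & P (c p)]].

End Forms.

(* Main.v *)
(* For p not dividing 2N the lift formula reads a(tp^2) = A(p) - eps p^(k-1) with
   |eps| <= 1, so for large p the sign of a(tp^2) is that of A(p) as soon as
   A(p) / (2 p^(k-1/2)) stays away from 0; likewise for b. By pair Sato-Tate each
   of the four sign combinations has lower density arbitrarily close to 1/4.
   Hence the positive and the negative primes each have lower density at least
   1/2, and being disjoint they both have density exactly 1/2. Infinitely many
   sign changes follow because a set of positive lower density is infinite. *)
Require Import Defs.
From HB Require Import structures.
From mathcomp Require Import all_boot all_order all_algebra.
From mathcomp Require Import complex.
From mathcomp Require Import all_classical all_reals all_analysis.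
From mathcomp Require Import ring lra.

Import Order.TTheory GRing.Theory Num.Theory.
Import numFieldNormedType.Exports.

Local Open Scope classical_set_scope.
Local Open Scope ring_scope.
Local Open Scope complex_scope.

(** * The Sato-Tate measure of intervals *)

(** An antiderivative of the Sato-Tate density; it is odd and runs from -1/2 to 1/2 on [-1,1]. *)
Definition semicircle_cdf {R : realType} (u : R) : R :=
  (u * Num.sqrt (1 - u ^+ 2) + asin u) / pi.

Lemma is_derive_semicircle_cdf {R : realType} {x : R} : -1 < x < 1 ->
  is_derive x 1 (@semicircle_cdf R) (2 / pi * Num.sqrt (1 - x ^+ 2)).
Proof.
move=> x1.
have y0 : 0 < 1 - x ^+ 2.
  by rewrite subr_gt0 expr2; case/andP: x1 => ? ?; nra.
have dasin := is_derive1_asin x1.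
have dpoly : is_derive x 1 (fun u : R => 1 - u ^+ 2) (- (2 * x)).
  by apply: is_derive_eq; rewrite /GRing.scale /=; ring.
have dsqrt : is_derive x 1 (fun u : R => Num.sqrt (1 - u ^+ 2))
    ((2 * Num.sqrt (1 - x ^+ 2))^-1 * - (2 * x)).
  exact: (@is_derive1_comp _ Num.sqrt (fun u : R => 1 - u ^+ 2) x _ _
           (is_derive1_sqrt y0) dpoly).
rewrite /semicircle_cdf.
have s0 : Num.sqrt (1 - x ^+ 2) != 0 by rewrite gt_eqF ?sqrtr_gt0.
have s2 : Num.sqrt (1 - x ^+ 2) ^+ 2 = 1 - x ^+ 2 by rewrite sqr_sqrtr ?ltW.
have pi0 : pi != 0 :> R by rewrite gt_eqF ?pi_gt0.
apply: is_derive_eq; rewrite /GRing.scale /= !mulr0 add0r mulr1.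
set s := Num.sqrt _ in s0 s2 *.
(* The derivative of [asin] is 1/s; writing its numerator as s^2 + x^2 gives s + x^2/s, whose last
   term cancels the one from differentiating the square root. *)
have -> : s^-1 = (s ^+ 2 + x ^+ 2) / s by rewrite s2 subrK mul1r.
by move: (pi : R) pi0 => q q0; field; rewrite q0.
Qed.

(** Fundamental theorem of calculus; the endpoints stay inside (-1,1), where the derivative of
    [semicircle_cdf] has been computed. *)
Lemma sato_tate_itv {R : realType} (x y : R) : -1 < x -> x < y -> y < 1 ->
  sato_tate [set` `[x, y]] = semicircle_cdf y - semicircle_cdf x.
Proof.
move=> x1 xy y1.
have inner z : x <= z <= y -> -1 < z < 1.
  by case/andP=> xz zy; rewrite (lt_le_trans x1 xz) (le_lt_trans zy y1).
have cdf_cont z : x <= z <= y -> {for z, continuous (@semicircle_cdf R)}.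
  move=> /inner/is_derive_semicircle_cdf dz.
  exact/differentiable_continuous/derivable1_diffP.
have xx : x <= x <= y by rewrite lexx ltW.
have yy : x <= y <= y by rewrite lexx ltW.
rewrite /sato_tate /Rintegral (@continuous_FTC2 _ _ (@semicircle_cdf R)) //.
- apply: continuous_subspaceT => z; apply: cvgM; first exact: cvg_cst.
  apply: (continuous_comp (f := fun u : R => 1 - u ^+ 2)); last exact: sqrt_continuous.
  by apply: cvgB; [exact: cvg_cst|exact: exprn_continuous].
- split; last 2 first.
  + exact/cvg_at_right_filter/cdf_cont.
  + exact/cvg_at_left_filter/cdf_cont.
  move=> z; rewrite in_itv /= => /andP[xz zy].
  have zb : x <= z <= y by rewrite !ltW.
  by have dz := is_derive_semicircle_cdf (inner _ zb).
- move=> z; rewrite in_itv /= => /andP[xz zy].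
  have zb : x <= z <= y by rewrite !ltW.
  rewrite derive1E; have dz := is_derive_semicircle_cdf (inner _ zb).
  exact: derive_val.
Qed.

Lemma semicircle_cdf_sin {R : realType} (x : R) : - (pi / 2) <= x <= pi / 2 ->
  semicircle_cdf (sin x) = (sin x * cos x + x) / pi.
Proof.
move=> x1; rewrite /semicircle_cdf sinK ?in_itv //.
by rewrite -cos2sin2 sqrtr_sqr ger0_norm // cos_ge0_pihalf.
Qed.

(* Endpoints of the form sin x keep asin out of the values: the boundary terms
   sin x cos x cancel between x = d and x = pi/2 - d. *)
Lemma sato_tate_sin {R : realType} (x y : R) : - (pi / 2) < x -> x < y ->
    y < pi / 2 ->
  sato_tate [set` `[sin x, sin y]] =
    (sin y * cos y - sin x * cos x + (y - x)) / pi.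
Proof.
move=> x1 xy y1; have pi0 := pi_gt0 R.
have inE z : x <= z <= y -> z \in `[- (pi / 2), pi / 2].
  by rewrite in_itv /= => /andP[xz zy]; apply/andP; split; lra.
have x_in : x \in `[- (pi / 2), pi / 2] by apply: inE; lra.
have y_in : y \in `[- (pi / 2), pi / 2] by apply: inE; lra.
rewrite sato_tate_itv ?ltr_sin //.
- rewrite !semicircle_cdf_sin; first by move: (pi : R) pi0 => q q0; field; rewrite gt_eqF.
  + by move: x_in; rewrite in_itv.
  + by move: y_in; rewrite in_itv.
- rewrite -(@sin_pihalf R) -sinN ltr_sin // in_itv /=; apply/andP; split; lra.
- rewrite -(@sin_pihalf R) ltr_sin // in_itv /=; apply/andP; split; lra.
Qed.

(** In the angle x with u = sin x this is [0, pi/2] trimmed by [d] at each end: it stays away from 0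
    and keeps nearly half of the mass. *)
Lemma sato_tate_right {R : realType} (d : R) : 0 < d < pi / 4 ->
  sato_tate [set` `[sin d, sin (pi / 2 - d)]] = 2^-1 - 2 / pi * d.
Proof.
case/andP => d0 d4; have pi0 := pi_gt0 R.
rewrite sato_tate_sin; [|lra..].
have -> : sin (pi / 2 - d) = cos d by rewrite -opprB sinN sinBpihalf opprK.
have -> : cos (pi / 2 - d) = sin d by rewrite -opprB cosN cosBpihalf.
by move: (pi : R) pi0 => q q0; field; rewrite gt_eqF.
Qed.

Lemma sato_tate_left {R : realType} (d : R) : 0 < d < pi / 4 ->
  sato_tate [set` `[sin (d - pi / 2), sin (- d)]] = 2^-1 - 2 / pi * d.
Proof.
case/andP => d0 d4; have pi0 := pi_gt0 R.
rewrite sato_tate_sin; [|lra..].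
rewrite sinBpihalf cosBpihalf sinN cosN.
by move: (pi : R) pi0 => q q0; field; rewrite gt_eqF.
Qed.

(** * Lower densities of sets of primes *)

Definition prime_count (S : set nat) (x : nat) : nat :=
  count (fun p => prime p && `[< S p >]) (iota 0 x.+1).

Definition prime_ratio {R : realType} (S : set nat) (x : nat) : R :=
  (prime_count S x)%:R / (count prime (iota 0 x.+1))%:R.

(** The liminf of the ratios is at least [l], in a form usable before a limit is known to exist. *)
Definition lower_density_ge {R : realType} (S : set nat) (l : R) : Prop :=
  forall e : R, 0 < e -> \forall x \near \oo, l - e <= prime_ratio S x.

Lemma count_prime_unbounded (n : nat) :
  exists m, (n <= count prime (iota 0 m))%N.
Proof.
elim: n => [|n [m nm]]; first by exists 0%N.
have [p mp pp] := prime_above m; exists p.+1.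
have -> : p.+1 = (m + (p - m) + 1)%N by rewrite subnKC ?(ltnW mp) // addn1.
rewrite !iotaD !count_cat add0n subnKC ?(ltnW mp) //= pp addn0.
by rewrite addn1 ltnS; apply: leq_trans nm (leq_addr _ _).
Qed.

Lemma count_prime_gt {R : realType} (r : R) :
  \forall x \near \oo, r < (count prime (iota 0 x.+1))%:R.
Proof.
have [n /= _ rn] := nbhs_infty_gtr r.
have [m nm] := count_prime_unbounded n.
exists m => // x mx.
have nx : (n <= count prime (iota 0 x.+1))%N.
  rewrite -(subnKC (leqW mx)) iotaD count_cat.
  exact: leq_trans nm (leq_addr _ _).
exact: lt_le_trans (rn n (leqnn n)) (eq_ind_r is_true nx (ler_nat _ _ _)).
Qed.

Lemma natural_density_lower {R : realType} (S : set nat) (l : R) :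
  natural_density S l -> lower_density_ge S l.
Proof.
move=> /cvgrPdist_le Sl e /Sl; apply: filterS => x.
by rewrite ler_distlC => /andP[].
Qed.

Lemma lower_density_ge_sup {R : realType} (S : set nat) (l : R) :
  (forall e : R, 0 < e -> lower_density_ge S (l - e)) -> lower_density_ge S l.
Proof.
move=> Sl e e0; have e2 : 0 < e / 2 by rewrite divr_gt0.
by apply: filterS (Sl _ e2 _ e2) => x; rewrite {3}(splitr e) opprD addrA.
Qed.

(** Disjointness makes the two counts add up, and at most m+1 numbers, 0 to [m], can escape [S]. *)
Lemma prime_count_tail (S1 S2 S : set nat) (m x : nat) :
  S1 `&` S2 = set0 -> (forall p, prime p -> (m < p)%N -> (S1 `|` S2) p -> S p) ->
  (prime_count S1 x + prime_count S2 x <= prime_count S x + m.+1)%N.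
Proof.
move=> S12 SS; rewrite /prime_count -count_predUI.
rewrite [X in (_ + X)%N](_ : _ = 0%N) ?addn0; last first.
  apply/eqP; rewrite eqn0Ngt -has_count; apply/hasPn => p _ /=.
  apply/negP => /andP[/andP[_ /asboolP S1p] /andP[_ /asboolP S2p]].
  by have : (S1 `&` S2) p by []; rewrite S12.
have le_m : (count (fun p => p <= m)%N (iota 0 x.+1) <= m.+1)%N.
  rewrite -size_filter -[X in (_ <= X)%N](size_iota 0); apply: uniq_leq_size.
    exact/filter_uniq/iota_uniq.
  by move=> p; rewrite mem_filter => /andP[pm _]; rewrite mem_iota add0n ltnS.
apply: leq_trans (leq_add (leqnn _) le_m).
rewrite -count_predUI (leq_trans _ (leq_addr _ _)) //; apply: sub_count => p /=.
case: leqP => [_ _|mp]; first by rewrite orbT.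
rewrite orbF -andb_orr => /andP[pp /orP S12p]; rewrite pp; apply/asboolP/SS => //.
by case: S12p => /asboolP; [left|right].
Qed.

(** Lower density is superadditive on disjoint sets; the exceptions up to [m] vanish after division
    by the prime count, which tends to infinity. *)
Lemma lower_density_geU {R : realType} {S1 S2 S : set nat} {m : nat} {l1 l2 : R} :
  S1 `&` S2 = set0 -> (forall p, prime p -> (m < p)%N -> (S1 `|` S2) p -> S p) ->
  lower_density_ge S1 l1 -> lower_density_ge S2 l2 ->
  lower_density_ge S (l1 + l2).
Proof.
(* One third of [e] for each of the two sets and one for the m+1 exceptions. *)
move=> S12 SS h1 h2 e e0; have e3 : 0 < e / 3 by rewrite divr_gt0.
near=> x.
have l1x : l1 - e / 3 <= prime_ratio S1 x by near: x; exact: h1.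
have l2x : l2 - e / 3 <= prime_ratio S2 x by near: x; exact: h2.
have mx : m.+1%:R / (e / 3) < (count prime (iota 0 x.+1))%:R.
  by near: x; exact: count_prime_gt.
have : (prime_count S1 x)%:R + (prime_count S2 x)%:R <=
    (prime_count S x)%:R + m.+1%:R :> R.
  by rewrite -!natrD ler_nat; exact: prime_count_tail.
move: l1x l2x mx; rewrite /prime_ratio.
move: (prime_count S1 x) (prime_count S2 x) (prime_count S x) => n1 n2 n.
move: (count prime _)%:R => c l1x l2x mx n12.
have c0 : 0 < c by apply: le_lt_trans mx; rewrite divr_ge0 // ltW.
rewrite ltr_pdivrMr // in mx.
rewrite ler_pdivlMr // in l1x; rewrite ler_pdivlMr // in l2x.
by rewrite ler_pdivlMr //; lra.
Unshelve. all: by end_near. Qed.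

(** [P] bounds the ratio of [Q] from below; [N] bounds it from above, since the ratios of the
    disjoint sets [Q] and [N] sum to at most 1. *)
Lemma natural_density_squeeze {R : realType} {P Q N : set nat} {l : R} :
  P `<=` Q -> Q `&` N = set0 ->
  lower_density_ge P l -> lower_density_ge N (1 - l) -> natural_density Q l.
Proof.
move=> PQ QN hP hN; apply/cvgrPdist_le => e e0; near=> x.
have Px : l - e <= prime_ratio P x by near: x; exact: hP.
have Nx : 1 - l - e <= prime_ratio N x by near: x; exact: hN.
have c0 : 0 < (count prime (iota 0 x.+1))%:R :> R.
  by near: x; exact: count_prime_gt.
rewrite ler_distlC; apply/andP; split.
  apply: le_trans Px _; rewrite ler_pM2r ?invr_gt0 // ler_nat.
  by apply: sub_count => p /andP[-> /asboolP Pp]; apply/asboolP/PQ.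
have : prime_ratio Q x + prime_ratio N x <= 1 :> R.
  rewrite -mulrDl ler_pdivrMr // mul1r -natrD ler_nat.
  rewrite /prime_count -count_predUI.
  rewrite [X in (_ + X)%N](_ : _ = 0%N) ?addn0; last first.
    apply/eqP; rewrite eqn0Ngt -has_count; apply/hasPn => p _ /=.
    apply/negP => /andP[/andP[_ /asboolP Qp] /andP[_ /asboolP Np]].
    by have : (Q `&` N) p by []; rewrite QN.
  by apply: sub_count => p /= /orP[] /andP[].
by rewrite -/(prime_count Q x) -/(prime_ratio Q x) /=; lra.
Unshelve. all: by end_near. Qed.

Lemma lower_density_ge_set0 {R : realType} : @lower_density_ge R set0 0.
Proof.
move=> e e0; apply: nearW => x.
by rewrite sub0r (le_trans _ (divr_ge0 _ _)) // oppr_le0 ltW.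
Qed.

(** If [S] had no prime beyond [m], superadditivity would give the empty set a lower density of at
    least [l]. *)
Lemma lower_density_gt0_infinite {R : realType} {S : set nat} {l : R} (m : nat) :
  0 < l -> lower_density_ge S l -> exists p, [/\ prime p, (m < p)%N & S p].
Proof.
move=> l0 Sl; apply: contrapT => noS.
have S0 p : prime p -> (m < p)%N -> (S `|` set0) p -> set0 p.
  by rewrite setU0 => pp mp Sp; apply: noS; exists p.
have l2 : 0 < l / 2 by rewrite divr_gt0.
have [x] := filter_ex (lower_density_geU (setI0 S) S0 Sl lower_density_ge_set0 _ l2).
rewrite /prime_ratio /prime_count (@eq_count _ _ pred0) ?count_pred0 ?mul0r.
  by rewrite addr0 {1}(splitr l) addrK leNgt l2.
by move=> p /=; rewrite asboolF ?andbF.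
Qed.

(** [P] and [N] together exhaust the total density 1, which leaves nothing for the primes outside
    both. *)
Lemma density_of_half_signs {R : realType} {P N : set nat} :
  P `&` N = set0 -> lower_density_ge P (2^-1 : R) ->
  lower_density_ge N (2^-1 : R) ->
  (forall Q, P `<=` Q -> Q `&` N = set0 -> natural_density Q (2^-1 : R)) /\
  (forall Q, Q `&` (P `|` N) = set0 -> natural_density Q (0 : R)).
Proof.
move=> PN hP hN; have half : 1 - 2^-1 = 2^-1 :> R by lra.
split=> Q.
  by move=> PQ QN; apply: (natural_density_squeeze PQ QN) => //; rewrite half.
move=> QPN; apply: (natural_density_squeeze (sub0set Q) QPN) => //.
  exact: lower_density_ge_set0.
have -> : 1 - 0 = 2^-1 + 2^-1 :> R by lra.
exact: (lower_density_geU (m := 0) PN).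
Qed.

(** * The Shimura lift at a prime *)

Lemma jacobi_prime (a : int) (p : nat) : prime p -> jacobi a p = legendre a p.
Proof.
by move=> pp; rewrite /jacobi primes_prime // big_seq1 logn_prime // eqxx expr1.
Qed.

Lemma normr_legendre (a : int) (p : nat) : `|legendre a p| <= 1.
Proof. by rewrite /legendre; case: ifP => // _; case: ifP. Qed.

Lemma perm_divisors_prime {p : nat} : prime p ->
  perm_eq (divisors p) [:: 1%N; p].
Proof.
move=> pp; apply: uniq_perm; first exact: divisors_uniq.
  by rewrite /= inE andbT neq_ltn prime_gt1.
move=> d; rewrite -dvdn_divisors ?prime_gt0 // !inE.
by apply/idP/orP => [/(primeP pp).2/orP|[] /eqP->] //; rewrite dvd1n.
Qed.

(** Only 1 and [p] divide [p], and both are prime to 2N. *)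
Lemma shimura_lift_prime {R : realType} (k N t : nat) (a : nat -> R[i]) (p : nat) :
  prime p -> ~~ (p %| 2 * N)%N ->
  shimura_lift k N t a p = a (t * p ^ 2)%N +
    (legendre ((-1) ^+ k * t%:Z) p)%:~R * (p ^ k.-1)%:R * a t.
Proof.
move=> pp pN; rewrite /shimura_lift (perm_big _ (perm_divisors_prime pp)) /=.
rewrite !big_cons big_nil coprime1n prime_coprime // pN /= addr0.
rewrite (jacobi_prime _ _ pp) /jacobi /= big_nil !exp1n divn1 mulr1 mul1r mulnK //.
by rewrite expn_gt0 prime_gt0.
Qed.

(* a(tp^2) = A(p) - eps p^(k-1) with |eps| <= 1; after normalization the
   correction is at most 1 / (2 sqrt p), which is < s as soon as p > (2s)^-2. *)
Lemma lift_coef_sign {R : realType} {k N t : nat} {a A : nat -> R[i]} {p : nat}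
    {s : R} (u : R) :
  (0 < k)%N -> a t = 1 -> A p = shimura_lift k N t a p ->
  prime p -> ~~ (p %| 2 * N)%N ->
  0 < s -> (2 * s) ^- 2 < p%:R -> normalized_coef k A p = u%:C ->
  (s <= u -> 0 < a (t * p ^ 2)%N) /\ (u <= - s -> a (t * p ^ 2)%N < 0).
Proof.
move=> k0 at1 Ap pp pN s0 ps Au.
have p0 : 0 < p%:R :> R by rewrite ltr0n prime_gt0.
pose eps : R := (legendre ((-1) ^+ k * t%:Z) p)%:~R.
have eps1 : `|eps| <= 1 by rewrite -intr_norm (ler_int _ _ 1) normr_legendre.
pose q : R := p%:R ^+ k.-1.
have q0 : 0 < q by rewrite exprn_gt0.
pose w : R := Num.sqrt p%:R.
have w0 : 0 < w by rewrite sqrtr_gt0.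
have powE : p%:R `^ (k%:R - 2^-1) = q * w.
  have -> : k%:R - 2^-1 = k.-1%:R + 2^-1 :> R.
    by rewrite -{1}(prednK k0) -addn1 natrD; lra.
  by rewrite powRD ?gt_eqF ?implybT // powR_mulrn ?ltW // powR12_sqrt ?ltW.
(* The threshold on [p] makes 2sw exceed 1, so for |u| >= s the main term 2wu outweighs [eps]. *)
have sw : 1 < 2 * s * w.
  have s2 : 0 < 2 * s by rewrite mulr_gt0.
  have w2 : w ^+ 2 = p%:R by rewrite sqr_sqrtr ?ltW.
  have : (2 * s)^-1 < w.
    by move: ps; rewrite -w2 -exprVn ltr_pXn2r // ?nnegrE ?invr_ge0 ?ltW.
  by rewrite -[_^-1]mulr1 ltr_pdivrMl.
have aE : a (t * p ^ 2)%N = (q * (2 * w * u - eps))%:C.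
  have := Ap; rewrite shimura_lift_prime // at1 mulr1 => Ap'.
  have AE : A p = (2 * (q * w) * u)%:C.
    rewrite rmorphM /= -Au /normalized_coef powE mulrC divfK //.
    by rewrite eq_complex /= eqxx andbT gt_eqF // mulr_gt0 // mulr_gt0.
  have -> : a (t * p ^ 2)%N = A p - (eps * q)%:C.
    by rewrite Ap' /eps /q -natrX rmorphM /= rmorph_int rmorph_nat addrK.
  by rewrite AE -rmorphB; congr (_%:C); ring.
have {}eps1 : -1 <= eps <= 1 by rewrite -ler_norml.
rewrite aE; split=> us; rewrite ltcR.
  rewrite pmulr_rgt0 //; nra.
rewrite pmulr_rlt0 //; nra.
Qed.

(** * From pair Sato-Tate to lower density one half *)

Lemma lower_density_ge_half {R : realType} (S : set nat) :
  (forall d : R, 0 < d < pi / 4 ->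
    lower_density_ge S ((2^-1 - 2 / pi * d) ^+ 2 + (2^-1 - 2 / pi * d) ^+ 2)) ->
  lower_density_ge S (2^-1 : R).
Proof.
move=> Sd; apply: lower_density_ge_sup => e e0 e' e'0.
have := pi_gt0 R; move: (pi : R) Sd => q Sd q0.
(* The first bound keeps d < pi/4; the second suffices because 2(1/2 - 2d/q)^2 >= 1/2 - 4d/q. *)
pose d := Num.min (q / 8) (q * e / 4).
have d0 : 0 < d by rewrite lt_min !divr_gt0 // mulr_gt0.
have d8 : d <= q / 8 by rewrite ge_min lexx.
have de : d <= q * e / 4 by rewrite ge_min lexx orbT.
have dq : 0 < d < q / 4 by rewrite d0 /=; lra.
apply: filterS (Sd _ dq _ e'0) => x; apply: le_trans; rewrite lerD2r.
have de' : d / q * 4 <= e.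
  by rewrite -ler_pdivlMr // ler_pdivrMr //; lra.
have -> : 2 / q * d = 2 * (d / q) by rewrite mulrAC -mulrA.
nra.
Qed.

(* [flip] selects between equal ([false]) and opposite ([true]) signs of the two
   coefficients. *)
Lemma pair_sato_tate_half {R : realType} {k1 N1 k2 N2 : nat}
    {A B : nat -> R[i]} (flip : bool) {S : set nat} :
  pair_sato_tate k1 N1 A k2 N2 B ->
  (forall s : R, 0 < s -> exists m, forall (p : nat) (u v : R),
    prime p -> ~~ (p %| 2 * N1 * N2)%N -> (m < p)%N ->
    normalized_coef k1 A p = u%:C -> normalized_coef k2 B p = v%:C ->
    (s <= u /\ s <= (-1) ^+ flip * v) \/ (u <= - s /\ (-1) ^+ flip * v <= - s) ->
    S p) ->
  lower_density_ge S (2^-1 : R).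
Proof.
move=> hST hS; apply: lower_density_ge_half => d d4.
have pi0 := pi_gt0 R; have [d0 d_lt] := andP d4.
have s0 : 0 < sin d by apply: sin_gt0_pi; rewrite d0 /=; lra.
have [m Sm] := hS _ s0.
(* [J true] lies to the right of 0 and [J false] to the left, both at distance sin d. *)
pose J (b : bool) : interval R :=
  if b then `[sin d, sin (pi / 2 - d)] else `[sin (d - pi / 2), sin (- d)].
have J1 b : [set` J b] `<=` [set` `[-1, 1]].
  by case: b => u /=; rewrite !in_itv /= => /andP[u1 u2];
    rewrite (le_trans _ u1) ?sin_geN1 // (le_trans u2) ?sin_le1.
have JE b : sato_tate [set` J b] = 2^-1 - 2 / pi * d.
  by case: b; [exact: sato_tate_right|exact: sato_tate_left].
have Jt u : u \in J true -> sin d <= u by rewrite in_itv => /andP[].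
have Jf u : u \in J false -> u <= - sin d.
  by rewrite in_itv => /andP[_]; rewrite sinN.
(* The second interval is on the same side as the first, or on the opposite side when [flip]
   holds. *)
have ST b := natural_density_lower _ _ (hST (J b) (J (b (+) flip)) (J1 _) (J1 _)).
have := lower_density_geU (m := m) _ _ (ST true) (ST false).
rewrite !JE -!expr2; apply.
  (* At a common [p] the normalized coefficient of [A] would be both >= sin d and <= -sin d. *)
  apply/seteqP; split=> // p /= [[_ _ [u /Jt su Au] _] [_ _ [v /Jf sv Av] _]].
  by move: Au; rewrite -Av => /complexI uv; move: su; rewrite uv; lra.
move=> p _ mp /= [] [pp pN [u Ju Au] [v Jv Bv]];
  apply: (Sm p u v) => //; [left|right].
  split; first exact: Jt.
  by case: flip Jv {hS Sm ST} => /= [/Jf|/Jt]; rewrite ?mulN1r ?mul1r; lra.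
split; first exact: Jf.
by case: flip Jv {hS Sm ST} => /= [/Jt|/Jf]; rewrite ?mulN1r ?mul1r; lra.
Qed.

(** * Sign changes and the five densities *)

Theorem theorem4p2 (R : realType) (k1 k2 N1 N2 t : nat)
  (f g F G : R[i] -> R[i]) (a b A B : nat -> R[i])
  (hk1 : (1 <= k1)%N) (hk2 : (1 <= k2)%N)
  (hN1 : odd N1 /\ squarefree N1) (hN2 : odd N2 /\ squarefree N2)
  (hf : new_half k1 N1 f) (hg : new_half k2 N2 g)
  (hfa : qexp f a) (hgb : qexp g b)
  (f_neq0 : exists2 z, upper_half z & f z <> 0)
  (g_neq0 : exists2 z, upper_half z & g z <> 0)
  (f_neq_g : exists2 z, upper_half z & f z <> g z)
  (f_eigen : hecke_eigen_half k1 N1 a)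
  (g_eigen : hecke_eigen_half k2 N2 b)
  (ht : squarefree t) (hat : a t = 1) (hbt : b t = 1)
  (hA : forall n, (0 < n)%N -> A n = shimura_lift k1 N1 t a n)
  (hB : forall n, (0 < n)%N -> B n = shimura_lift k2 N2 t b n)
  (hFA : qexp F A) (hGB : qexp G B)
  (hF : new_int (2 * k1) (2 * N1) F) (hG : new_int (2 * k2) (2 * N2) G)
  (F_eigen : hecke_eigen_int (2 * k1) (2 * N1) A)
  (G_eigen : hecke_eigen_int (2 * k2) (2 * N2) B)
  (no_twist : ~ is_twist A B /\ ~ is_twist B A)
  (hST : pair_sato_tate k1 N1 A k2 N2 B) :
  let c := fun p : nat => a (t * p ^ 2)%N * b (t * p ^ 2)%N in
  sign_changes_infinitely_often c /\
  [/\ natural_density (good_primes N1 N2 c (fun x => 0 < x)) (2^-1 : R),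
      natural_density (good_primes N1 N2 c (fun x => x < 0)) (2^-1 : R),
      natural_density (good_primes N1 N2 c (fun x => 0 <= x)) (2^-1 : R),
      natural_density (good_primes N1 N2 c (fun x => x <= 0)) (2^-1 : R) &
      natural_density (good_primes N1 N2 c (fun x => x == 0)) (0 : R)].
Proof.
move=> c; clear hf hg hfa hgb f_neq0 g_neq0 f_neq_g f_eigen g_eigen hFA hGB.
clear hF hG F_eigen G_eigen no_twist hN1 hN2 ht.
(* The bound [m] depends on [s] alone, so one threshold serves both forms. *)
have signs (s : R) : 0 < s -> exists m, forall (p : nat) (u v : R),
    prime p -> ~~ (p %| 2 * N1 * N2)%N -> (m < p)%N ->
    normalized_coef k1 A p = u%:C -> normalized_coef k2 B p = v%:C ->
    ((s <= u -> 0 < a (t * p ^ 2)%N) /\ (u <= - s -> a (t * p ^ 2)%N < 0)) /\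
    ((s <= v -> 0 < b (t * p ^ 2)%N) /\ (v <= - s -> b (t * p ^ 2)%N < 0)).
  move=> s0; exists (Num.bound ((2 * s) ^- 2)) => p u v pp pN mp Au Bv.
  have ps : (2 * s) ^- 2 < p%:R.
    apply: lt_trans (_ : (Num.bound ((2 * s) ^- 2))%:R < _); last by rewrite ltr_nat.
    by apply: archi_boundP; rewrite invr_ge0 exprn_ge0 // mulr_ge0 // ltW.
  have pN1 : ~~ (p %| 2 * N1)%N by apply: contra pN; exact: dvdn_mulr.
  have pN2 : ~~ (p %| 2 * N2)%N.
    by apply: contra pN => pN2; rewrite mulnAC dvdn_mulr.
  split.
    exact: (lift_coef_sign u hk1 hat (hA p (prime_gt0 pp)) pp pN1 s0 ps Au).
  exact: (lift_coef_sign v hk2 hbt (hB p (prime_gt0 pp)) pp pN2 s0 ps Bv).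
pose P := good_primes N1 N2 c (fun x => 0 < x).
pose N := good_primes N1 N2 c (fun x => x < 0).
have hP : lower_density_ge P (2^-1 : R).
  apply: (pair_sato_tate_half false hST) => s /signs[m sm]; exists m.
  move=> p u v pp pN mp Au Bv uv; split=> //; rewrite /c.
  have [[a0 a1] [b0 b1]] := sm p u v pp pN mp Au Bv.
  case: uv; rewrite mul1r => -[us vs]; first by rewrite mulr_gt0 ?a0 ?b0.
  by rewrite nmulr_rgt0 ?a1 ?b1.
have hN : lower_density_ge N (2^-1 : R).
  apply: (pair_sato_tate_half true hST) => s /signs[m sm]; exists m.
  move=> p u v pp pN mp Au Bv uv; split=> //; rewrite /c.
  have [[a0 a1] [b0 b1]] := sm p u v pp pN mp Au Bv.
  case: uv; rewrite mulN1r => -[us vs].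
    by rewrite pmulr_rlt0 ?a0 ?b1 // lerNr.
  by rewrite nmulr_rlt0 ?a1 ?b0 // -lerN2.
have disj (p q : R[i] -> bool) : (forall x, p x -> q x -> False) ->
    good_primes N1 N2 c p `&` good_primes N1 N2 c q = set0.
  move=> pq; apply/seteqP; split=> // r [[_ _ pr] [_ _ qr]].
  exact: pq pr qr.
have PN : P `&` N = set0 by apply: disj => x /lt_trans h /h; rewrite ltxx.
have [half zero] := density_of_half_signs PN hP hN.
have NP : N `&` P = set0 by rewrite setIC.
have [half' _] := density_of_half_signs NP hN hP.
have half0 : 0 < 2^-1 :> R by rewrite invr_gt0.
split=> [m|].
  have [p [pp mp [_ _ cp]]] := lower_density_gt0_infinite m half0 hP.
  have [q [qq mq [_ _ cq]]] := lower_density_gt0_infinite m half0 hN.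
  by split; [exists p|exists q].
split.
- exact: half.
- exact: half'.
(* The set for [>=] contains [P] and misses [N], so the squeeze applies; the set for [<=] is
   symmetric. *)
- apply: half; first by move=> p [pp pN /ltW cp].
  by apply: disj => x /le_lt_trans h /h; rewrite ltxx.
- apply: half'; first by move=> p [pp pN /ltW cp].
  by apply: disj => x x0 /lt_le_trans - /(_ _ x0); rewrite ltxx.
- by apply: zero; rewrite setIUr !disj ?setU0 // => x /eqP ->; rewrite ltxx.
Qed.
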